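(* Let $\ell\ge 1$ be an integer. Assume that (i) $q_1,\dots,q_\ell\in\mathbb{Q}[z]$ are polynomials with $q_j(n)\in\mathbb{N}$ for every integer $n\ge 0$ and every $1\le j\le \ell$, and put $\Delta:=\max(\deg q_1,\dots,\deg q_\ell)$, where $\Delta\ge 1$; (ii) $(X,T)$ is a transitive dynamical system having quasi-discrete spectrum of order $d_T$, where $1\le d_T\le\infty$; (iii) $(c_n)_{n\ge 0}$ is a sequence of complex numbers that is oscillating of order $d_T\Delta$ (fully oscillating if $d_T=\infty$) and satisfies $\sum_{n=1}^{N}|c_n|=O(N)$ as $N\to\infty$. Then for every continuous function $F\in C(X^\ell)$ (complex valued) and every point $x\in X$, $$\lim_{N\to\infty}\frac1N\sum_{n=0}^{N-1}c_n\,F\bigl(T^{q_1(n)}x,\dots,T^{q_\ell(n)}x\bigr)=0 .$$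
   Context: $\mathbb{N}=\{0,1,2,\dots\}$ and $T^0$ is the identity. Oscillating sequences. For an integer $d\ge 1$, a sequence of complex numbers $(c_n)_{n\ge 0}$ is oscillating of order $d$ if for every real polynomial $P\in\mathbb{R}[z]$ of degree at most $d$ one has $\lim_{N\to\infty}\frac1N\sum_{n=0}^{N-1}c_n e^{2\pi i P(n)}=0$. It is fully oscillating (oscillating of order $\infty$) if it is oscillating of order $d$ for all $d\ge 1$. Dynamical systems. A dynamical system is a pair $(X,T)$ where $X$ is a compact metric space and $T:X\to X$ is a continuous map. It is transitive if there is some $x\in X$ whose orbit $\{T^nx:n\ge 0\}$ is dense in $X$. $C(X)$ is the Banach algebra of continuous complex valued functions on $X$ with the sup norm. Quasi-discrete spectrum. Let $(X,T)$ be a transitive dynamical system and let $G(X)=\{f\in C(X): |f(x)|=1 \text{ for all } x\in X\}$, a group under pointwise multiplication. Let $G_1$ be the set of all $f\in G(X)$ for which there is $\lambda\in\mathbb{C}$ with $f\circ T=\lambda f$. Inductively, for $n\ge 1$, let $G_{n+1}$ be the set of all $f\in G(X)$ for which there is $g\in G_n$ with $f\circ T=g f$. Then $G_1\subset G_2\subset\cdots$. The elements of $G:=\bigcup_{n\ge 1}G_n$ are called quasi-eigenfunctions. The system $(X,T)$ has quasi-discrete spectrum if the algebra generated by the quasi-eigenfunctions is dense in $C(X)$. If $(X,T)$ has quasi-discrete spectrum, its order $d_T$ is the least integer $d\ge 1$ such that $G_d=G_{d+1}$, and $d_T=\infty$ if there is no such integer. *)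

(* Defs.v *)
From HB Require Import structures.
From mathcomp Require Export all_boot all_order all_algebra.
From mathcomp Require Export all_classical all_reals all_analysis.
From mathcomp Require Export complex.

Set Implicit Arguments.
Unset Strict Implicit.
Unset Printing Implicit Defensive.

Export Order.TTheory GRing.Theory Num.Theory.
Export numFieldNormedType.Exports.

#[global] Open Scope classical_set_scope.
#[global] Open Scope ring_scope.

(* [R[i]] with the topology and norm it carries as a numFieldType. *)
HB.instance Definition _ (R : realType) := NormedModule.copy R[i] R[i]^o.

(* exp(2 i pi t) for real t; the library has no complex exponential. *)
Definition e2ipi (R : realType) (t : R) : R[i] :=
  (cos (2 * pi * t) +i* sin (2 * pi * t))%C.

Definition oscillating (R : realType) (d : nat) (c : nat -> R[i]) : Prop :=
  forall P : {poly R}, (size P <= d.+1)%N ->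
    (fun N : nat => N%:R^-1 * \sum_(0 <= n < N) c n * e2ipi P.[n%:R])
      @ \oo --> (0 : R[i]).

(* Orders live in {1, 2, ...} with infinity added; [None] is infinity. *)
Definition oscillating_ext (R : realType) (d : option nat) (c : nat -> R[i]) :
    Prop :=
  match d with
  | Some d => oscillating d c
  | None => forall d, (1 <= d)%N -> oscillating d c
  end.

Section QuasiDiscreteSpectrum.
Context {R : realType} {X : metricType R}.
Implicit Types (T : X -> X) (f g : X -> R[i]) (A : set (X -> R[i])).

Definition transitive_map T : Prop :=
  exists x : X, dense [set iter n T x | n in [set: nat]].

Definition unimodular : set (X -> R[i]) :=
  [set f | continuous f /\ forall x, `|f x| = 1].

Definition eigenfun T : set (X -> R[i]) :=
  [set f | unimodular f /\ exists lambda : R[i], f \o T = (fun x => lambda * f x)].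

(* Indexed from 1; the value at 0 is a dummy. *)
Fixpoint quasi_eigen T (n : nat) : set (X -> R[i]) :=
  match n with
  | 0 => set0
  | 1 => eigenfun T
  | m.+1 => [set f | unimodular f /\
               exists2 g, quasi_eigen T m g & f \o T = (fun x => g x * f x)]
  end.

Definition quasi_eigenfuns T : set (X -> R[i]) :=
  \bigcup_(n in [set n | (1 <= n)%N]) quasi_eigen T n.

Definition subalgebra A : Prop :=
  [/\ forall (a : R[i]) f, A f -> A (fun x => a * f x),
      forall f g, A f -> A g -> A (fun x => f x + g x)
    & forall f g, A f -> A g -> A (fun x => f x * g x)].

(* The constant 1 is an eigenfunction, so it does not matter that
   [subalgebra] does not ask for a unit. For the density, the topology of
   [{uniform X -> R[i]}] induces on C(X) the one given by the sup norm. *)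
Definition quasi_discrete_spectrum T : Prop :=
  [set f : {uniform X -> R[i]} | continuous (f : X -> R[i])] `<=`
    closure (smallest subalgebra (quasi_eigenfuns T) :
               set {uniform X -> R[i]}).

Definition spectrum_order T (d : option nat) : Prop :=
  match d with
  | Some d => [/\ (1 <= d)%N, quasi_eigen T d = quasi_eigen T d.+1 &
      forall e, (1 <= e < d)%N -> quasi_eigen T e <> quasi_eigen T e.+1]
  | None => forall e, (1 <= e)%N -> quasi_eigen T e <> quasi_eigen T e.+1
  end.

End QuasiDiscreteSpectrum.

(* The zero polynomial counts as having degree 0 here. *)
Definition max_degree (l : nat) (q : 'I_l -> {poly rat}) : nat :=
  \max_(j < l) (size (q j)).-1.

(* Main.v *)
Require Import Defs.

Set Implicit Arguments.
Unset Strict Implicit.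
Unset Printing Implicit Defensive.

(** The point is that a system with quasi-discrete spectrum only produces
    polynomial phases. Write e(t) = exp(2 i pi t). If f is a quasi-eigenfunction in
    G_k, then f(T^n x) = e(P(n)) for a real polynomial P of degree at most k: going
    from G_k to G_{k+1} amounts to finding a polynomial with a prescribed forward
    difference ([poly_antidifference], [quasi_eigen_phase]). When d_T is finite the
    groups G_k are all equal from k = d_T on, so the degree can always be taken at
    most d_T ([quasi_eigenfuns_phase]).

    Let the d-class be the uniform closure of the linear combinations of sequences
    e(P(n)) with deg P <= d ([phase_approx]). It is an algebra. Since the
    quasi-eigenfunctions generate a dense algebra, n |-> f(T^n x) is in the
    d_T-class for every continuous f ([continuous_phase_approx]), and replacing n by
    q_j(n) leads to the (d_T Delta)-class ([phase_approx_comp]).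

    A continuous F on X^l is a uniform limit of finite sums of products
    f_1(y_1) ... f_l(y_l) of continuous functions; a partition of unity of the
    compact metric space X gives such sums explicitly ([product_sum_approx]). Hence
    n |-> F(T^{q_1(n)} x, ..., T^{q_l(n)} x) is in the (d_T Delta)-class as well.

    Finally, the means of c_n e(P(n)) tend to 0 for deg P <= d_T Delta by the
    hypothesis of oscillation, and the boundedness of the means of |c_n| lets this
    pass to linear combinations and uniform limits ([mean_null_phase_approx]). *)

(** * The exponential and discrete antiderivatives of polynomials *)

Lemma e2ipiD (R : realType) (s t : R) : e2ipi (s + t) = e2ipi s * e2ipi t.
Proof.
rewrite /e2ipi mulrDr cosD sinD; apply/eqP; rewrite eq_complex /=.
by rewrite eqxx /= addrC [cos _ * sin _]mulrC.
Qed.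

Lemma e2ipi0 (R : realType) : e2ipi (0 : R) = 1.
Proof. by rewrite /e2ipi mulr0 cos0 sin0. Qed.

Lemma norm_e2ipi (R : realType) (t : R) : `|e2ipi t| = 1.
Proof. by rewrite normc_def /= cos2Dsin2 sqrtr1. Qed.

Lemma unit_circleP (R : realType) (z : R[i]) :
  `|z| = 1 -> exists t : R, z = e2ipi t.
Proof.
move=> z1.
have : `|z| ^+ 2 = 1 by rewrite z1 expr1n.
have -> : `|z| ^+ 2 = (complex.Re z ^+ 2 + complex.Im z ^+ 2)%:C%C.
  by rewrite normc_def -rmorphXn /= sqr_sqrtr ?addr_ge0 ?sqr_ge0.
case: z {z1} => a b /= [ab].
have a1 : -1 <= a <= 1.
  rewrite -ler_norml -(@ler_pXn2r _ 2) ?nnegrE ?normr_ge0//.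
  by rewrite expr1n real_normK ?num_real// -ab lerDl sqr_ge0.
have pi2 : 2 * pi != 0 :> R by rewrite mulf_neq0 ?pnatr_eq0 ?gt_eqF ?pi_gt0.
have sb : sin (acos a) = `|b|.
  by rewrite sin_acos// -ab addrC addKr sqrtr_sqr.
have acosaK : cos (acos a) = a by apply: acosK; rewrite in_itv.
(* [acos] only reaches the upper half circle; the lower half is obtained by
   changing the sign of the angle. *)
case: (leP 0 b) => b0.
  exists (acos a / (2 * pi)); rewrite /e2ipi mulrCA divff ?mulr1// acosaK sb.
  by rewrite ger0_norm.
exists (- (acos a / (2 * pi))); rewrite /e2ipi mulrN mulrCA divff ?mulr1//.
by rewrite cosN sinN acosaK sb ltr0_norm ?opprK.
Qed.

(** The falling factorial x (x - 1) ... (x - k + 1): the basis of polynomials in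
    which the forward difference acts as differentiation acts on monomials. *)
Definition falling_poly (R : nzRingType) (k : nat) : {poly R} :=
  \prod_(i < k) ('X - (i%:R)%:P).

Lemma size_falling_poly (R : idomainType) k : size (falling_poly R k) = k.+1.
Proof. by rewrite /falling_poly size_prod_XsubC /= /index_enum -enumT size_enum_ord. Qed.

Lemma falling_poly_diff (R : comNzRingType) (k : nat) (x : R) :
  (falling_poly R k.+1).[x + 1] - (falling_poly R k.+1).[x] =
  k.+1%:R * (falling_poly R k).[x].
Proof.
have shift i : (x + 1 - i.+1%:R) = x - i%:R by rewrite -natr1 opprD addrACA subrr addr0.
rewrite {1}/falling_poly big_ord_recl /falling_poly big_ord_recr /= !hornerM.
rewrite !horner_prod !hornerXsubC subr0.
under eq_bigr => i _ do rewrite hornerXsubC /bump add1n shift.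
under [in X in _ - X]eq_bigr => i _ do rewrite hornerXsubC.
under [in RHS]eq_bigr => i _ do rewrite hornerXsubC.
rewrite [X in _ - X]mulrC -mulrBl; congr (_ * _).
by rewrite opprB addrCA [x + 1]addrC addrK natr1.
Qed.

(** Peel off the top coefficient of Q along the falling factorials: by
    [falling_poly_diff] the one of degree k is the difference of the next one
    divided by k + 1, and what remains of Q has smaller size. *)
Lemma poly_antidifference (R : numFieldType) (k : nat) (Q : {poly R}) :
  (size Q <= k)%N ->
  exists2 P : {poly R}, (size P <= k.+1)%N &
    forall x, P.[x + 1] - P.[x] = Q.[x].
Proof.
elim: k Q => [|k IH] Q sQ.
  exists 0; first by rewrite size_poly0.
  by move: sQ; rewrite leqn0 size_poly_eq0 => /eqP -> x; rewrite !horner0 subrr.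
have ffmonic : falling_poly R k \is monic by apply: monic_prod_XsubC.
pose a := Q`_k.
have ffk : (falling_poly R k)`_k = 1.
  by move/monicP: ffmonic; rewrite /lead_coef size_falling_poly.
have [] := IH (Q - a *: falling_poly R k).
  apply/leq_sizeP => j; rewrite leq_eqVlt => /predU1P[<-|kj].
    by rewrite coefB coefZ ffk mulr1 subrr.
  rewrite coefB coefZ (nth_default 0 (leq_trans sQ kj)).
  by rewrite (nth_default 0 (leq_trans _ kj)) ?size_falling_poly// mulr0 subrr.
move=> P sP HP; exists (P + (a / k.+1%:R) *: falling_poly R k.+1).
  rewrite (leq_trans (size_polyD _ _))// geq_max (leq_trans sP)//=.
  by rewrite (leq_trans (size_scale_leq _ _))// size_falling_poly.
move=> x; rewrite !(hornerD, hornerZ) opprD addrACA HP -mulrBr falling_poly_diff.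
by rewrite hornerD hornerN hornerZ mulrA divfK ?pnatr_eq0// subrK.
Qed.

(** * Uniform limits of polynomial phases *)

Definition degree_le (R : nzRingType) (d : option nat) (P : {poly R}) : bool :=
  if d is Some k then (size P <= k.+1)%N else true.

Lemma degree_le0 (R : nzRingType) (d : option nat) : degree_le d (0 : {poly R}).
Proof. by case: d => //= k; rewrite size_poly0. Qed.

Lemma degree_leD (R : nzRingType) (d : option nat) (P Q : {poly R}) :
  degree_le d P -> degree_le d Q -> degree_le d (P + Q).
Proof.
by case: d => //= k sP sQ; rewrite (leq_trans (size_polyD _ _))// geq_max sP.
Qed.

Lemma degree_le_comp (R : nzRingType) (d : option nat) (D : nat)
    (P q : {poly R}) :
  degree_le d P -> (size q <= D.+1)%N ->
  degree_le (omap (muln^~ D) d) (P \Po q).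
Proof.
case: d => //= k sP sq; rewrite (leq_trans (size_comp_poly_leq _ _))// ltnS.
by apply: leq_mul; [case: (size P) sP | case: (size q) sq].
Qed.

Definition phase_sum (R : realType) (s : seq (R[i] * {poly R})) (n : nat) :
    R[i] :=
  \sum_(t <- s) t.1 * e2ipi t.2.[n%:R].

Lemma phase_sum_bounded (R : realType) (s : seq (R[i] * {poly R})) :
  exists2 M : R[i], 0 < M & forall n, `|phase_sum s n| <= M.
Proof.
exists (1 + \sum_(t <- s) `|t.1|) => [|n].
  by rewrite ltr_pwDl// sumr_ge0.
rewrite (le_trans (ler_norm_sum _ _ _))// (@le_trans _ _ (\sum_(t <- s) `|t.1|))//.
  by apply: ler_sum => t _; rewrite normrM norm_e2ipi mulr1.
by rewrite lerDr.
Qed.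

(** The sequences that the continuous functions of the system produce along an
    orbit lie in this class; it is the uniform closure of the linear combinations
    of phases e(P(n)) with P of degree at most d, any degree being accepted when d
    is [None]. *)
Definition phase_approx (R : realType) (d : option nat) (v : nat -> R[i]) :
    Prop :=
  forall eps : R[i], 0 < eps ->
    exists2 s : seq (R[i] * {poly R}), all (fun t => degree_le d t.2) s &
      forall n, `|v n - phase_sum s n| <= eps.

Section PhaseApprox.
Variables (R : realType) (d : option nat).
Implicit Types (u v : nat -> R[i]).

Lemma phase_approx_phase (P : {poly R}) :
  degree_le d P -> phase_approx d (fun n => e2ipi P.[n%:R]).
Proof.
move=> dP eps eps0; exists [:: (1, P)] => [|n] /=; first by rewrite dP.
by rewrite /phase_sum big_seq1 mul1r subrr normr0 ltW.
Qed.

Lemma phase_approx_unif v :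
  (forall eps : R[i], 0 < eps ->
    exists2 u, phase_approx d u & forall n, `|v n - u n| <= eps) ->
  phase_approx d v.
Proof.
move=> Hv eps eps0; have e2 : 0 < eps / 2 by rewrite divr_gt0.
have [u Hu uv] := Hv _ e2; have [s ds us] := Hu _ e2.
exists s => // n; rewrite (le_trans (ler_distD (u n) _ _))// (splitr eps).
by rewrite lerD.
Qed.

Lemma phase_approx_bounded v :
  phase_approx d v -> exists2 M : R[i], 0 < M & forall n, `|v n| <= M.
Proof.
move=> Hv; have [s _ vs] := Hv 1 ltr01; have [M M0 sM] := phase_sum_bounded s.
exists (1 + M) => [|n]; first by rewrite addr_gt0.
rewrite -[v n](subrK (phase_sum s n)).
by rewrite (le_trans (ler_normD _ _))// lerD.
Qed.

Lemma phase_approxD u v :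
  phase_approx d u -> phase_approx d v -> phase_approx d (fun n => u n + v n).
Proof.
move=> Hu Hv eps eps0; have e2 : 0 < eps / 2 by rewrite divr_gt0.
have [s ds us] := Hu _ e2; have [t dt vt] := Hv _ e2.
exists (s ++ t) => [|n]; first by rewrite all_cat ds.
rewrite /phase_sum big_cat /= opprD addrACA.
by rewrite (le_trans (ler_normD _ _))// (splitr eps) lerD// [_ - _](us, vt).
Qed.

(** The product of two phases is the phase of the sum of the polynomials, so
    multiplication does not raise the degree. *)
Lemma phase_approxM u v :
  phase_approx d u -> phase_approx d v -> phase_approx d (fun n => u n * v n).
Proof.
move=> Hu Hv eps eps0; have e2 : 0 < eps / 2 by rewrite divr_gt0.
have [M M0 uM] := phase_approx_bounded Hu.
(* u v - s t = u (v - t) + (u - s) t, with M bounding u and B bounding t; the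
   error allowed for s depends on the choice of t. *)
have [t dt vt] := Hv _ (divr_gt0 e2 M0).
have [B B0 tB] := phase_sum_bounded t.
have [s ds us] := Hu _ (divr_gt0 e2 B0).
exists [seq (a.1 * b.1, a.2 + b.2) | a <- s, b <- t] => [|n].
  apply/all_allpairsP => a b /(allP ds) /= da /(allP dt) /= db.
  exact: degree_leD.
have -> : phase_sum [seq (a.1 * b.1, a.2 + b.2) | a <- s, b <- t] n =
          phase_sum s n * phase_sum t n.
  rewrite /phase_sum big_allpairs_dep big_distrlr; apply: eq_bigr => a _.
  by apply: eq_bigr => b _; rewrite hornerD e2ipiD mulrACA.
have -> : u n * v n - phase_sum s n * phase_sum t n =
          u n * (v n - phase_sum t n) + (u n - phase_sum s n) * phase_sum t n.
  by rewrite mulrBr mulrBl addrA subrK.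
rewrite (le_trans (ler_normD _ _))// (splitr eps) !normrM lerD//.
  by rewrite -[leRHS](mulfVK (lt0r_neq0 M0)) mulrC ler_pM.
by rewrite -[leRHS](mulfVK (lt0r_neq0 B0)) ler_pM.
Qed.

Lemma phase_approx_cst (a : R[i]) : phase_approx d (fun=> a).
Proof.
move=> eps eps0; exists [:: (a, 0)] => [|n]; first by rewrite /= degree_le0.
by rewrite /phase_sum big_seq1 /= horner0 e2ipi0 mulr1 subrr normr0 ltW.
Qed.

Lemma phase_approx_sum (I : Type) (r : seq I) (u : I -> nat -> R[i]) :
  (forall i, phase_approx d (u i)) ->
  phase_approx d (fun n => \sum_(i <- r) u i n).
Proof.
move=> Hu; elim: r => [|i r IH].
  by under eq_fun do rewrite big_nil; apply: phase_approx_cst.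
by under eq_fun do rewrite big_cons; apply: phase_approxD.
Qed.

Lemma phase_approx_prod (I : Type) (r : seq I) (u : I -> nat -> R[i]) :
  (forall i, phase_approx d (u i)) ->
  phase_approx d (fun n => \prod_(i <- r) u i n).
Proof.
move=> Hu; elim: r => [|i r IH].
  by under eq_fun do rewrite big_nil; apply: phase_approx_cst.
by under eq_fun do rewrite big_cons; apply: phase_approxM.
Qed.

(** Substituting a polynomial of degree at most D into a phase multiplies its
    degree by at most D; this is where the order of oscillation d_T Delta comes
    from. *)
Lemma phase_approx_comp (D : nat) (q : {poly R}) (m : nat -> nat) v :
  (size q <= D.+1)%N -> (forall n, (m n)%:R = q.[n%:R]) ->
  phase_approx d v -> phase_approx (omap (muln^~ D) d) (v \o m).
Proof.
move=> sq mq Hv eps eps0; have [s ds vs] := Hv _ eps0.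
exists [seq (t.1, t.2 \Po q) | t <- s] => [|n].
  by rewrite all_map; apply: sub_all ds => t /= dt; apply: degree_le_comp.
have -> : phase_sum [seq (t.1, t.2 \Po q) | t <- s] n = phase_sum s (m n).
  by rewrite /phase_sum big_map; apply: eq_bigr => t _; rewrite /= horner_comp mq.
exact: vs.
Qed.

End PhaseApprox.

(** * Quasi-eigenfunctions along an orbit *)

Section QuasiEigen.
Variables (R : realType) (X : metricType R) (T : X -> X).

(** A function of G_{j+1} satisfies f(T^{n+1} x) = g(T^n x) f(T^n x) with g in
    G_j, so the exponent of f along the orbit has the exponent of g as its forward
    difference: its degree is at most one more. The base case is the same step with the
    constant eigenvalue in place of g. *)
Lemma quasi_eigen_phase (k : nat) (f : X -> R[i]) (x : X) :
  quasi_eigen T k f ->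
  exists2 P : {poly R}, (size P <= k.+1)%N &
    forall n, f (iter n T x) = e2ipi P.[n%:R].
Proof.
have integrate j h (g : nat -> R[i]) (P : {poly R}) :
    unimodular h -> (size P <= j.+1)%N -> (forall n, g n = e2ipi P.[n%:R]) ->
    (forall n, h (iter n.+1 T x) = g n * h (iter n T x)) ->
    exists2 Q : {poly R}, (size Q <= j.+2)%N &
      forall n, h (iter n T x) = e2ipi Q.[n%:R].
  move=> [_ h1] sP gP hg; have [Q sQ QP] := poly_antidifference sP.
  have [t ht] := unit_circleP (h1 x).
  (* An antidifference is determined up to a constant, which is used to match the
     value at n = 0. *)
  exists (Q + (t - Q.[0])%:P) => [|n].
    rewrite (leq_trans (size_polyD _ _))// geq_max sQ /=.
    by rewrite (leq_trans (size_polyC_leq1 _)).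
  rewrite hornerD hornerC; elim: n => [|n IH].
    by rewrite /= mulr0n addrC subrK.
  by rewrite hg IH gP -e2ipiD -natr1 -QP addrA subrK.
elim: k f => [|[|k] IH] f; first by [].
  move=> [uf [lam Tf]]; have [t ht] : exists t : R, lam = e2ipi t.
    apply: unit_circleP; have /(congr1 (fun h => `|h x|)) := Tf.
    by rewrite /= normrM !(proj2 uf) mulr1.
  apply: (integrate _ _ (fun=> lam) t%:P) => //; first exact: size_polyC_leq1.
    by move=> n; rewrite hornerC.
  by move=> n; have /(congr1 (@^~ (iter n T x))) := Tf.
move=> [uf [g /IH [P sP gP] Tf]].
apply: (integrate _ _ (fun n => g (iter n T x)) P) => // n.
by have /(congr1 (@^~ (iter n T x))) := Tf.
Qed.

(** G_{n+1} is obtained from G_n by an operation that does not depend on n, so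
    once two consecutive groups agree the sequence is constant. *)
Lemma quasi_eigen_stable (d k : nat) :
  (1 <= d)%N -> quasi_eigen T d = quasi_eigen T d.+1 ->
  quasi_eigen T (d + k) = quasi_eigen T d.
Proof.
case: d => // d _ Hd; elim: k => [|k IH]; first by rewrite addn0.
have step m : quasi_eigen T m.+2 = [set f | unimodular f /\
  exists2 g, quasi_eigen T m.+1 g & f \o T = (fun x => g x * f x)] by [].
by rewrite addnS [RHS]Hd addSn !step -addSn IH.
Qed.

Lemma quasi_eigenfuns_phase (d : option nat) (f : X -> R[i]) (x : X) :
  spectrum_order T d -> quasi_eigenfuns T f ->
  exists2 P : {poly R}, degree_le d P &
    forall n, f (iter n T x) = e2ipi P.[n%:R].
Proof.
move=> dT [k /= k1 fk]; case: d dT => [d|] /= dT; last first.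
  by have [P _ fP] := quasi_eigen_phase x fk; exists P.
have [d1 Hd _] := dT; have [kd|/ltnW dk] := leqP k d.
  have [P sP fP] := quasi_eigen_phase x fk.
  by exists P => //; rewrite (leq_trans sP).
move: fk; rewrite -(subnKC dk) quasi_eigen_stable//.
exact: quasi_eigen_phase.
Qed.

(** The functions whose orbit sequence is a uniform limit of phases of degree at
    most d form a uniformly closed algebra that contains the quasi-eigenfunctions,
    hence all continuous functions when the spectrum is quasi-discrete. *)
Lemma continuous_phase_approx (d : option nat) (f : X -> R[i]) (x : X) :
  spectrum_order T d -> quasi_discrete_spectrum T -> continuous f ->
  phase_approx d (fun n => f (iter n T x)).
Proof.
move=> dT qT cf; apply: phase_approx_unif => eps eps0.
pose B := [set h : {uniform X -> R[i]} | forall y, `|f y - h y| <= eps].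
have nB : nbhs (f : {uniform X -> R[i]}) B.
  apply/uniform_nbhs; exists [set z | `|z.1 - z.2| < eps]; split.
    by rewrite -entourage_ballE; exists eps.
  by move=> h fh y; apply/ltW/fh.
have [h [Ah Bh]] := qT f cf B nB.
exists (fun n => h (iter n T x)) => [|n]; last exact: Bh.
pose A := [set h : X -> R[i] | phase_approx d (fun n => h (iter n T x))].
suff sA : smallest subalgebra (quasi_eigenfuns T) `<=` A by exact: sA.
apply: smallest_sub.
  split=> [a g Ag|g1 g2 A1 A2|g1 g2 A1 A2].
  - by apply: phase_approxM => //; apply: phase_approx_cst.
  - exact: phase_approxD.
  - exact: phase_approxM.
move=> g /(quasi_eigenfuns_phase x dT)[P dP gP].
by rewrite /A /=; under eq_fun do rewrite gP; apply: phase_approx_phase.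
Qed.

End QuasiEigen.

(** * Continuous functions on a finite power of a compact metric space *)

Section Boxes.
Variables (R : realType) (X : metricType R) (l : nat).
Implicit Types (y z : 'I_l -> X) (F : {ptws 'I_l -> X} -> R[i]).

(** The filter generated by the boxes of equal sides around y converges to y in
    the product topology, because it does so coordinate by coordinate. *)
Lemma continuous_box F y (eps : R[i]) :
  continuous F -> 0 < eps ->
  exists2 delta : R, 0 < delta &
    forall z, (forall j, mdist (y j) (z j) < delta) -> `|F y - F z| < eps.
Proof.
move=> cF eps0.
pose box (delta : R) : set ('I_l -> X) :=
  [set z | forall j, mdist (y j) (z j) < delta].
pose G := filter_from [set delta : R | 0 < delta] box.
have FG : Filter G.
  apply: filter_from_filter => [|a b a0 b0]; first by exists 1 => /=.
  exists (Num.min a b); first by rewrite /= lt_min a0.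
  by move=> z Hz; split=> j; have := Hz j; rewrite lt_min => /andP[].
have Gy : G --> (y : {ptws 'I_l -> X}).
  apply/cvg_sup => j U [B [[A oA <-] Ay] AU].
  have /nbhs_ballP[delta /= delta0 Hdelta] : nbhs (y j) A by exact: open_nbhs_nbhs.
  exists delta => // z Hz; apply: AU; apply: Hdelta.
  by rewrite ballEmdist /=; apply: Hz.
have /cvgrPdist_lt/(_ _ eps0)[delta delta0 Hdelta] : F @ G --> F y.
  by apply: cvg_comp Gy (cF y).
by exists delta.
Qed.

(** Heine-Cantor for the sup distance of the coordinates. The near-covering form
    of compactness gives the common delta: it needs one that works for all points
    close to a given y, and half of the one given by [continuous_box] at y does. *)
Lemma compact_unif_box F (eps : R[i]) :
  compact [set: X] -> continuous F -> 0 < eps ->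
  exists2 delta : R, 0 < delta &
    forall y z, (forall j, mdist (y j) (z j) < delta) -> `|F y - F z| < eps.
Proof.
move=> cX cF eps0.
have : near_covering [set: {ptws 'I_l -> X}].
  apply/compact_near_coveringP.
  have -> : [set: {ptws 'I_l -> X}] = [set f | forall i : 'I_l, [set: X] (f i)].
    by apply/seteqP; split.
  by apply: (@tychonoff _ (fun _ : 'I_l => X) (fun=> setT)).
move=> /(_ R (0^'+ : set_system R) (fun (delta : R) y => forall z,
  (forall j, mdist (y j) (z j) < delta) -> `|F y - F z| < eps)).
case=> [y _|e /= e0 He].
  have [delta delta0 Hdelta] := continuous_box y cF (divr_gt0 eps0 (ltr0Sn _ 1)).
  have d2 : 0 < delta / 2 by rewrite divr_gt0.
  exists ([set y' | forall j, mdist (y j) (y' j) < delta / 2],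
          [set d : R | d < delta / 2]).
    split => /=; last exact: nbhs_right_lt.
    have Hj j : nbhs (y : {ptws 'I_l -> X})
        [set y' : {ptws 'I_l -> X} | mdist (y j) (y' j) < delta / 2].
      have -> : [set y' : {ptws 'I_l -> X} | mdist (y j) (y' j) < delta / 2] =
          proj j @^-1` ball (y j) (delta / 2) by rewrite ballEmdist.
      by apply: proj_continuous; apply: nbhsx_ballx.
    have near_all := filter_forall (nbhs_filter _) Hj; exact: near_all.
  case=> y' d /= [yy' dd] z y'z.
  rewrite (le_lt_trans (ler_distD (F y) _ _))// (splitr eps) ltrD//.
    rewrite distrC Hdelta// => j; rewrite (lt_trans (yy' j))//.
    by rewrite [ltRHS]splitr ltrDl.
  rewrite Hdelta// => j; rewrite (le_lt_trans (metric_triangle _ (y' j) _))//.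
  by rewrite (splitr delta) ltrD// (lt_trans (y'z j)).
exists (e / 2); first by rewrite divr_gt0.
move=> y z; apply: (He (e / 2)) => //=.
  by rewrite sub0r normrN gtr0_norm ?divr_gt0// ltr_pdivrMr// mulr_natr mulr2n ltrDl.
by rewrite divr_gt0.
Qed.
End Boxes.

Lemma real_complex_continuous (R : realType) :
  continuous (fun r : R => r%:C%C : R[i]).
Proof.
move=> r; apply/cvgrPdist_lt => -[eps im].
rewrite ltcE /= => /andP[/eqP -> eps0].
have /cvgrPdist_lt/(_ _ eps0) : (id : R -> R) @ r --> r by exact: cvg_id.
apply: filterS => s rs; rewrite -rmorphB /= normc_def /= expr0n addr0.
by rewrite sqrtr_sqr ltcR.
Qed.

Section PartitionOfUnity.
Variables (R : realType) (X : metricType R).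

Lemma mdist_continuous (a : X) : continuous (fun x : X => mdist a x : R).
Proof.
move=> x; apply/cvgrPdist_lt => eps eps0.
have : \forall y \near x, ball x eps y by exact: nbhsx_ballx.
apply: filterS => y; rewrite ballEmdist /= => xy.
rewrite (le_lt_trans _ xy)// ler_norml lerBlDr lerBrDr.
have -> : - mdist x y + mdist a y = mdist a y - mdist x y by rewrite addrC.
rewrite lerBlDr metric_triangle /= addrC.
by rewrite (metric_sym x y) metric_triangle.
Qed.

(** Near-covering compactness applied to the filter of the finite subsets of X
    ordered by inclusion: a set that contains the point x serves every point of
    the delta-ball around x. *)
Lemma compact_net (delta : R) :
  compact [set: X] -> 0 < delta ->
  exists (I : finType) (a : I -> X), forall x, exists i, mdist (a i) x < delta.
Proof.
move=> /compact_near_coveringP cX delta0.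
pose G := filter_from [set: seq X] (fun s => [set t : seq X | {subset s <= t}]).
have FG : Filter G.
  apply: filter_from_filter => [|s t _ _]; first by exists [::].
  by exists (s ++ t) => // r st; split=> x xs; apply: st; rewrite mem_cat xs ?orbT.
have [x _|s _ /(_ s (fun _ => id)) Hs] := cX (seq X) G
    (fun s x => exists2 a, a \in s & mdist a x < delta) FG.
  exists (ball x delta, [set t : seq X | x \in t]) => [|[y t] /= []].
    by split; [exact: nbhsx_ballx | exists [:: x] => //= t; apply; rewrite inE].
  by rewrite ballEmdist => xy xt; exists x.
exists (seq_sub s), (fun i => ssval i) => x; have [a ains ax] := Hs x I.
by exists (SeqSub ains).
Qed.

(** Tent functions of width delta around the points of a delta-net, normalised by
    their sum, which does not vanish because the net meets every ball. *)
Lemma partition_of_unity (delta : R) :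
  compact [set: X] -> 0 < delta ->
  exists (I : finType) (a : I -> X) (phi : I -> X -> R[i]),
    [/\ forall i, continuous (phi i),
        forall i x, 0 <= phi i x,
        forall x, \sum_i phi i x = 1
      & forall i x, phi i x != 0 -> mdist (a i) x < delta].
Proof.
move=> cX delta0; have [I [a net]] := compact_net cX delta0.
pose b i (x : X) : R := Num.max 0 (delta - mdist (a i) x).
pose S (x : X) : R := \sum_i b i x.
have b0 i x : 0 <= b i x by rewrite le_max lexx.
have S0 x : 0 < S x.
  have [i ix] := net x; rewrite /S (bigD1 i)//= ltr_pwDl ?sumr_ge0//.
  by rewrite lt_max subr_gt0 ix orbT.
have cb i : continuous (b i : X -> R).
  move=> x; apply: (@continuous_max R X (fun=> 0) _ x); first exact: cvg_cst.
  by apply: cvgB; [apply: cvg_cst | apply: mdist_continuous].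
have cS : continuous (S : X -> R).
  move=> x; apply: cvg_big => [|i _]; [exact: add_continuous | exact: cb].
exists I, a, (fun i x => (b i x / S x)%:C%C); split=> [i x|i x|x|i x].
- apply: (@cvg_comp _ _ _ (fun x => b i x / S x)); last first.
    exact: real_complex_continuous.
  by apply: cvgM; [apply: cb | apply: cvgV; [rewrite gt_eqF | apply: cS]].
- by rewrite lecR divr_ge0// ltW.
- by rewrite -rmorph_sum -mulr_suml (divff (lt0r_neq0 (S0 x))).
- rewrite fmorph_eq0 mulf_eq0 negb_or => /andP[+ _].
  apply: contraNT; rewrite -leNgt -subr_le0 => ?.
  by apply/eqP/max_idPl.
Qed.

End PartitionOfUnity.

(** The products of the
    functions of a partition of unity, one for each coordinate, form a partition
    of unity of X^l; weighting them by the values of F at their centres changes F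
    by at most its oscillation on a box. *)
Lemma product_sum_approx (R : realType) (X : metricType R) (l : nat)
    (F : {ptws 'I_l -> X} -> R[i]) (eps : R[i]) :
  compact [set: X] -> continuous F -> 0 < eps ->
  exists (I : finType) (b : {ffun 'I_l -> I} -> R[i]) (phi : I -> X -> R[i]),
    (forall i, continuous (phi i)) /\
    forall y, `|F y - \sum_k b k * \prod_j phi (k j) (y j)| <= eps.
Proof.
move=> cX cF eps0; have [delta delta0 Fdelta] := compact_unif_box cX cF eps0.
have [I [a [phi [cphi phi0 phi1 supp]]]] := partition_of_unity cX delta0.
exists I, (fun k => F (fun j => a (k j))), phi; split=> // y.
have one : \sum_(k : {ffun 'I_l -> I}) \prod_j phi (k j) (y j) = 1.
  by rewrite -(bigA_distr_bigA (fun j i => phi i (y j))) big1.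
(* F(y) - sum_k b_k w_k = sum_k (F(y) - b_k) w_k since the weights w_k add up to
   1, and a term with w_k nonzero has its centre close to y. *)
have split_by_one (r : R[i]) :
    r = \sum_(k : {ffun 'I_l -> I}) r * \prod_j phi (k j) (y j).
  by rewrite -mulr_sumr one mulr1.
rewrite [F y]split_by_one -sumrB [leRHS]split_by_one.
rewrite (le_trans (ler_norm_sum _ _ _))//; apply: ler_sum => k _.
rewrite /= -mulrBl normrM [`|\prod_j _|]ger0_norm ?prodr_ge0//.
have [->|nz] := eqVneq (\prod_j phi (k j) (y j)) 0; first by rewrite !mulr0.
rewrite ler_wpM2r ?prodr_ge0// distrC ltW// Fdelta// => j; apply: supp.
by move/prodf_neq0: nz; apply.
Qed.

(** * Means of oscillating sequences *)

Definition mean_null (R : realType) (u : nat -> R[i]) : Prop :=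
  (fun N : nat => N%:R^-1 * \sum_(0 <= n < N) u n) @ \oo --> (0 : R[i]).

Lemma cvg0_lin (K : numFieldType) (a : K) (f g : nat -> K) :
  f @ \oo --> (0 : K) -> g @ \oo --> (0 : K) ->
  (fun N => a * f N + g N) @ \oo --> (0 : K).
Proof.
move=> f0 g0; rewrite -[X in _ --> X]addr0; apply: cvgD => //.
by rewrite -[X in _ --> X](mulr0 a); apply: cvgMl_tmp.
Qed.

Lemma mean_null_lin (R : realType) (a : R[i]) (u v : nat -> R[i]) :
  mean_null u -> mean_null v -> mean_null (fun n => a * u n + v n).
Proof.
rewrite /mean_null => /(cvg0_lin a)/[apply]; congr (_ @ \oo `=>` _).
apply/funext => N; rewrite mulrCA -mulrDr mulr_sumr -big_split.
by congr (_ * _).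
Qed.

Lemma mean_null_phase_sum (R : realType) (d : option nat) (c : nat -> R[i])
    (s : seq (R[i] * {poly R})) :
  oscillating_ext d c -> all (fun t => degree_le d t.2) s ->
  mean_null (fun n => c n * phase_sum s n).
Proof.
move=> osc; elim: s => [_|[a P] s IH /= /andP[dP ds]].
  rewrite /mean_null (_ : (fun N => _) = fun=> 0); first exact: cvg_cst.
  by apply/funext => N; rewrite big1 ?mulr0// => n _; rewrite /phase_sum big_nil mulr0.
have oP : mean_null (fun n => c n * e2ipi P.[n%:R]).
  case: d osc dP {IH ds} => [k|] osc dP; first exact: osc.
  (* Full oscillation only speaks of orders d >= 1, hence the maximum. *)
  by apply: (osc (maxn 1 (size P))); rewrite ?leq_maxl// leqW// leq_maxr.
have := mean_null_lin a oP (IH ds); congr mean_null.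
by apply/funext => n; rewrite /phase_sum big_cons mulrDr mulrCA.
Qed.

(** Uniform approximation passes to the weighted means because the means of |c_n|
    are bounded. *)
Lemma mean_null_phase_approx (R : realType) (d : option nat) (c v : nat -> R[i]) :
  oscillating_ext d c ->
  (fun N : nat => \sum_(1 <= n < N.+1) `|c n|) =O_\oo (fun N => N%:R : R[i]) ->
  phase_approx d v -> mean_null (fun n => c n * v n).
Proof.
move=> osc /eqO_exP[K K0 cK] Hv; apply/cvgrPdist_le => eps eps0.
(* The hypothesis on the sums of |c_n| starts at n = 1; the term |c_0| is added
   to the constant. *)
pose B := `|c 0%N| + K; have B0 : 0 < B by rewrite ltr_wpDl.
have [s ds vs] := Hv (eps / 2 / B) (divr_gt0 (divr_gt0 eps0 (ltr0Sn _ 1)) B0).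
have /cvgrPdist_le/(_ _ (divr_gt0 eps0 (ltr0Sn _ 1))) := mean_null_phase_sum osc ds.
move=> near_s; near=> N.
have N1 : (1 <= N)%N by near: N; exists 1%N.
have NK : \sum_(1 <= n < N.+1) `|c n| <= K * N%:R.
  suff : `|\sum_(1 <= n < N.+1) `|c n| | <= K * `|N%:R|.
    by rewrite normr_nat ger0_norm// sumr_ge0.
  by near: N.
have N0 : 0 < N%:R :> R[i] by rewrite ltr0n.
have -> : \sum_(0 <= n < N) c n * v n = \sum_(0 <= n < N) c n * phase_sum s n +
    \sum_(0 <= n < N) c n * (v n - phase_sum s n).
  by rewrite -big_split; apply: eq_bigr => n _ /=; rewrite -mulrDr addrC subrK.
rewrite sub0r normrN mulrDr (le_trans (ler_normD _ _))// (splitr eps) lerD//.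
  rewrite -normrN -sub0r; near: N; exact: near_s.
rewrite normrM normfV normr_nat ler_pdivrMl//.
rewrite (le_trans (ler_norm_sum _ _ _))//.
apply: (@le_trans _ _ (\sum_(0 <= n < N) `|c n| * (eps / 2 / B))).
  by apply: ler_sum => n _; rewrite normrM ler_wpM2l.
rewrite -mulr_suml [leLHS]mulrA ler_pdivrMr// [leRHS]mulrAC.
rewrite ler_wpM2r ?divr_ge0 ?(ltW eps0)// mulrDr big_ltn// lerD//.
  by rewrite ler_peMl// ler1n.
rewrite mulrC (le_trans _ NK)// big_nat_recr//= lerDl.
by rewrite normr_ge0.
Unshelve. all: end_near. Qed.

(** * Polynomial times *)

Lemma rat_poly_orbit_index (R : realType) (q : {poly rat}) (n : nat) :
  q.[n%:R] \is a Num.nat ->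
  (Num.truncn q.[n%:R])%:R = (map_poly (ratr : rat -> R) q).[n%:R].
Proof.
by move=> qn; rewrite -(ratr_nat R n) horner_map -[in RHS](truncnK qn) /= ratr_nat.
Qed.

Theorem theorem1 (R : realType) (l : nat) (hl : (1 <= l)%N)
    (q : 'I_l -> {poly rat})
    (hq : forall (j : 'I_l) (n : nat), (q j).[n%:R] \is a Num.nat)
    (hDelta : (1 <= max_degree q)%N)
    (X : metricType R) (hX : compact [set: X])
    (T : X -> X) (hT : continuous T) (hTtrans : transitive_map T)
    (hqds : quasi_discrete_spectrum T)
    (dT : option nat) (hdT : spectrum_order T dT)
    (c : nat -> R[i])
    (hosc : oscillating_ext (omap (fun d => (d * max_degree q)%N) dT) c)
    (hbound : (fun N : nat => \sum_(1 <= n < N.+1) `|c n|)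
                =O_\oo (fun N : nat => N%:R : R[i]))
    (F : {ptws 'I_l -> X} -> R[i]) (hF : continuous F) (x : X) :
  (fun N : nat => N%:R^-1 * \sum_(0 <= n < N)
     c n * F (fun j : 'I_l => iter (Num.truncn (q j).[n%:R]) T x))
    @ \oo --> (0 : R[i]).
Proof.
apply: (mean_null_phase_approx hosc hbound).
set D := max_degree q; apply: phase_approx_unif => eps eps0.
have [I [b [phi [cphi Fapprox]]]] := product_sum_approx hX hF eps0.
exists (fun n => \sum_k b k * \prod_j phi (k j)
    (iter (Num.truncn (q j).[n%:R]) T x)); last by move=> n; apply: Fapprox.
apply: phase_approx_sum => k; apply: phase_approxM; first exact: phase_approx_cst.
apply: phase_approx_prod => j.
have sq : (size (map_poly (ratr : rat -> R) (q j)) <= D.+1)%N.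
  rewrite size_map_poly (leq_trans (leqSpred _))// ltnS.
  exact: (leq_bigmax_cond (F := fun i => (size (q i)).-1)).
apply: (phase_approx_comp sq (v := fun n => phi (k j) (iter n T x))) => [n|].
  exact: rat_poly_orbit_index.
exact: continuous_phase_approx hdT hqds (cphi (k j)).
Qed.
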